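(* Let $(T,d)$ be a finite metric tree. For all $q,t\in\mathbb{N}$ and all normalized $(q,t)$-simplexes $D(\vec{\omega})=[a_j(m_j);b_i(n_i)]_{q,t}$ in $T$ we have $$\sum_{1\le j_1<j_2\le q} m_{j_1}m_{j_2}\,d(a_{j_1},a_{j_2})+\sum_{1\le i_1<i_2\le t} n_{i_1}n_{i_2}\,d(b_{i_1},b_{i_2})+\Bigl\{\sum_{e\in E(T)}|e|^{-1}\Bigr\}^{-1}\ \le\ \sum_{j=1}^{q}\sum_{i=1}^{t} m_j n_i\, d(a_j,b_i).$$ Moreover, equality holds if and only if $D=T$ as sets (every vertex of $T$ is a vertex of $D$) and $D$ is both generically labeled and generically weighted.
   Context: A finite metric tree $(T,d)$ is a finite connected graph $T$ without cycles (identified with its vertex set), each edge carrying a positive weight, where $d(x,y)$ is the sum of the weights of the edges on the unique path $[x,y]$ from $x$ to $y$. $E(T)$ is the set of edges and $|e|=d(x,y)$ for an edge $e=(x,y)$. A $(q,t)$-simplex in $T$ ($q,t\in\mathbb{N}=\{1,2,\dots\}$) is a vector $D=[a_j;b_i]_{q,t}=(a_1,\dots,a_q,b_1,\dots,b_t)$ of $q+t$ pairwise distinct vertices of $T$; the $a_j$ are said to have simplex parity $a$ and the $b_i$ simplex parity $b$. A normalized $(q,t)$-simplex $D(\vec\omega)=[a_j(m_j);b_i(n_i)]_{q,t}$ is a $(q,t)$-simplex $D$ together with a normalized load vector $\vec\omega=(m_1,\dots,m_q,n_1,\dots,n_t)$, i.e. all $m_j,n_i>0$ and $m_1+\cdots+m_q=1=n_1+\cdots+n_t$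 ($m_j$ is the weight of $a_j$, $n_i$ the weight of $b_i$). $T_D$ is the minimal subtree of $T$ containing the vertices of $D$ (all vertices lying on some geodesic between two vertices of $D$). $D$ is generically labeled if $D=T_D$ as sets and the two endpoints of every edge of $T_D$ have opposite simplex parity. Generic weights (for $D=T$ generically labeled): fix a leaf $\ell$ of $T$ as root. For each vertex $v\neq\ell$ let $e(v)$ be the edge joining $v$ to the neighbor of $v$ closer to $\ell$, and let $L(v)$ be the set of vertices $u$ with $v\in[u,\ell]$ (including $v$). Given $\delta>0$, the generic algorithm assigns weights $w(v)$ recursively, starting with the vertices having the greatest number of edges between them and $\ell$ and moving towards $\ell$: for $v\ne\ell$, $$w(v)=\sum_{u\in L(v),\ u\text{ of parity opposite to }v} w(u)\ -\sum_{u\in L(v)\setminus\{v\},\ u\text{ of the same parity as }v} w(u)\ +\ \frac{\delta}{|e(v)|},$$ and finally $w(\ell)=1-\sum w(u)$, the sum over all $u\ne\ell$ of the same parity as $\ell$. The vector so obtained is a normalized load vector for $D$ exactly when $\delta=\{\sum_{e\in E(T)}|e|^{-1}\}^{-1}$; $D$ is generically weighted if $\vec\omega$ is this unique normalized load vector $\vec\omega_G$. *)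

(* Defs.v *)
From mathcomp Require Import all_boot all_order all_algebra.

Set Implicit Arguments.
Unset Strict Implicit.
Unset Printing Implicit Defensive.

Import Order.TTheory GRing.Theory Num.Theory.
Local Open Scope ring_scope.

Definition edge_rel (V : finType) (E : {set {set V}}) : rel V :=
  fun x y => [set x; y] \in E.

(* [:: x; y] is a cycle in the sense of path.v as soon as x and y are adjacent,
   hence the bound 2 in [acyclicT]. *)
Record metric_tree (R : realFieldType) := MetricTree {
  vertex :> finType;
  edges : {set {set vertex}};
  elen : {set vertex} -> R;
  card_edge : forall e, e \in edges -> #|e| = 2%N;
  connectedT : forall x y, connect (edge_rel edges) x y;
  acyclicT : forall c, ucycle (edge_rel edges) c -> (size c <= 2)%N;
  elen_gt0 : forall e, e \in edges -> 0 < elen e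
}.

Section Tree.
Variables (R : realFieldType) (T : metric_tree R).
Implicit Types (x y u v l : T) (p : seq T).

Definition adj : rel T := edge_rel (edges T).

Definition simple_path x y : pred (seq T) :=
  fun p => [&& path adj x p, last x p == y & uniq (x :: p)].

Lemma simple_path_exists x y : exists p, simple_path x y p.
Proof.
have /connectP [p Hp ->] := connectedT x y.
by case: (shortenP Hp) => p' Hp' Up' _; exists p'; apply/and3P.
Qed.

(* As in path.v, the starting point x is not listed in [tree_path x y]. *)
Definition tree_path x y : seq T := xchoose (simple_path_exists x y).

Definition geodesic x y : {set T} := [set z in x :: tree_path x y].

Definition walk_edges x p : seq {set T} := pairmap (fun u v => [set u; v]) x p.

Definition dist x y : R := \sum_(e <- walk_edges x (tree_path x y)) elen e.

Definition generic_delta : R := (\sum_(e in edges T) (elen e)^-1)^-1.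

Definition is_leaf l : bool := #|[set y | adj l y]| == 1%N.

Definition descendants l v : {set T} := [set u | v \in geodesic u l].

Definition parent l v : T :=
  odflt v [pick y | adj v y && (dist y l < dist v l)].

Definition parent_edge l v : {set T} := [set v; parent l v].

Lemma adj_sym x y : adj x y = adj y x.
Proof. by rewrite /adj /edge_rel setUC. Qed.

Lemma simple_path_behead x y z p :
  simple_path x y (z :: p) -> simple_path z y p.
Proof. by case/and3P=> /= /andP[_ Hp] Hl /andP[_ Up]; apply/and3P. Qed.

Lemma simple_path_inj x y p p' :
  simple_path x y p -> simple_path x y p' -> p = p'.
Proof.
elim: p x p' => [|a p IHp] x p'.
  case/and3P=> _ /= /eqP <- _ /and3P[_ Hl].
  case: p' Hl => //= b p' /eqP Hl /andP[+ _].
  by rewrite -{1}Hl mem_last.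
case: p' => [|b p'].
  case/and3P=> _ /= /eqP Hl /andP[+ _] /and3P[_ /= /eqP Hy _].
  by rewrite Hy -Hl mem_last.
have [-> Hp Hp'|nab] := eqVneq a b.
  by congr cons; apply: (IHp b); [move: Hp | move: Hp']; apply: simple_path_behead.
case/and3P=> Hp Hl Up /and3P[Hp' Hl' Up']; exfalso.
have hs : has (mem (b :: p')) (a :: p).
  apply/hasP; exists y; first by rewrite -(eqP Hl) /= mem_last.
  by rewrite inE -(eqP Hl') /= mem_last.
have Ea : forall z s1 s2, a :: p = rcons s1 z ++ s2 -> s1 = [::] -> z = a.
  by move=> z s1 s2 + E; rewrite E => -[].
have Eb : forall z s1 s2, b :: p' = rcons s1 z ++ s2 -> s1 = [::] -> z = b.
  by move=> z s1 s2 + E; rewrite E => -[].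
move: Hp Up Ea; case: (split_find hs) => z s1 s2 /= Hz Hs1 Hp Up Ea.
have Ez := Ea _ _ _ erefl.
have {}Hz : z \in b :: p' by [].
move: Hp' Up' Eb Hs1; case: (path.splitP Hz) => t1 t2 Hp' Up' Eb Hs1.
have Fz := Eb _ _ _ erefl.
have Hc : ucycle adj (x :: s1 ++ z :: rev t1).
  apply/andP; split.
    rewrite /cycle -cats1 -catA /= -cat_rcons cats1 cat_path.
    move: Hp; rewrite cat_path => /andP[-> _] /=; rewrite last_rcons.
    move: Hp'; rewrite cat_path => /andP[+ _].
    rewrite -rev_path last_rcons belast_rcons rev_cons.
    by apply: sub_path => u v /=; rewrite adj_sym.
  rewrite cons_uniq mem_cat in_cons mem_rev cat_uniq cons_uniq mem_rev rev_uniq.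
  move: Up Up' Hs1.
  rewrite !cons_uniq !mem_cat !mem_rcons !in_cons !negb_or !cat_uniq !rcons_uniq.
  case/andP=> /andP[/andP[-> ->] _] /andP[/andP[zs1 ->] _].
  case/andP=> /andP[/andP[_ ->] _] /andP[/andP[-> ->] _] /hasPn nH /=.
  rewrite (negPf zs1) /= andbT; apply/hasPn => u; rewrite mem_rev => ut.
  apply/negP => us; have /negP[] := nH _ us.
  by rewrite [mem _ _]mem_cat mem_rcons inE ut orbT.
have := acyclicT Hc; rewrite /= size_cat /= size_rev => le2.
have s10 : s1 = [::] by case: (s1) le2 => // ? ?; rewrite addSn addnS.
have t10 : t1 = [::] by case: (t1) le2 => // ? ?; rewrite !addnS.
by move: nab; rewrite -(Ez s10) (Fz t10) eqxx.
Qed.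

Lemma tree_pathP x y : simple_path x y (tree_path x y).
Proof. exact: xchooseP. Qed.

Lemma tree_pathE x y p : simple_path x y p -> tree_path x y = p.
Proof. exact/simple_path_inj/tree_pathP. Qed.

Lemma dist_edge x y : adj x y -> dist x y = elen [set x; y].
Proof.
move=> xy; rewrite /dist (@tree_pathE _ _ [:: y]) ?big_seq1 //.
rewrite /simple_path /= xy eqxx !inE !andbT; apply/eqP => exy.
by have := card_edge xy; rewrite exy setUid cards1.
Qed.

Lemma size_tree_path x y : (size (tree_path x y) < #|T|)%N.
Proof.
case/and3P: (tree_pathP x y) => _ _ Up.
by rewrite -[_.+1]/(size (x :: _)) -(card_uniqP Up) max_card.
Qed.

Lemma descendants_size l u v : u \in descendants l v -> u != v ->
  (size (tree_path v l) < size (tree_path u l))%N.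
Proof.
rewrite !inE eq_sym => /orP[->//|Hv] _.
have := tree_pathP u l; case: (path.splitP Hv) => p1 p2 Hp.
rewrite (@tree_pathE v l p2) ?size_cat ?size_rcons; first by rewrite addSn ltnS leq_addl.
case/and3P: Hp; rewrite cat_path last_cat last_rcons => /andP[_ Hp] Hl.
rewrite /= cat_uniq rcons_uniq => /andP[_ /and3P[_ /hasPn Hn Up]].
apply/and3P; split=> //=; rewrite Up andbT.
by apply/negP => /Hn; rewrite /= mem_rcons mem_head.
Qed.

Lemma leaf_exists : (1 < #|T|)%N -> exists l : T, is_leaf l.
Proof.
case/card_gt1P=> x [x' [_ _ nxx']].
pose h v := size (tree_path x v).
case: (@arg_maxnP T x' predT h isT) => v _ Hmax; exists v.
have: (0 < h v)%N.
  apply: leq_trans (Hmax x' isT); rewrite lt0n size_eq0; apply/eqP => E.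
  by move: nxx'; case/and3P: (tree_pathP x x'); rewrite E /= => _ ->.
rewrite /h in Hmax *; move: (tree_pathP x v) Hmax.
case/lastP: (tree_path x v) => // p v' Hp Hmax _.
case/and3P: (Hp) => Hpath + Hu; rewrite last_rcons => /eqP ev; subst v'.
rewrite /is_leaf; suff -> : [set y | adj v y] = [set last x p] by rewrite cards1.
apply/setP => y; rewrite !inE; apply/idP/eqP => [vy|->]; last first.
  by move: Hpath; rewrite rcons_path adj_sym => /andP[].
have nyv : y != v.
  apply: contraTneq vy => ->; apply/negP => /card_edge.
  by rewrite setUid cards1.
have [yp|nyp] := boolP (y \in x :: rcons p v); last first.
  have := Hmax y isT; rewrite (@tree_pathE x y (rcons (rcons p v) y)).
    by rewrite /= !size_rcons ltnn.
  apply/and3P; rewrite rcons_path Hpath !last_rcons vy; split=> //.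
  by rewrite -rcons_cons rcons_uniq nyp.
have {}yp : y \in x :: p by move: yp; rewrite -rcons_cons mem_rcons inE (negPf nyv).
move: Hp Hpath Hu; case: (splitPl yp) => p1 p2 ly Hp Hpath Hu.
suff E : rcons p1 v = rcons (p1 ++ p2) v.
  by case/rcons_inj: E => <-.
apply: simple_path_inj Hp; apply/and3P; split; rewrite ?last_rcons //.
  move: Hpath; rewrite !rcons_path cat_path -andbA => /andP[-> _] /=.
  by rewrite ly adj_sym.
move: Hu; rewrite /= !rcons_uniq !mem_rcons !inE !mem_cat !negb_or cat_uniq.
by case/andP=> /and3P[-> -> _] /and3P[/andP[-> _] -> _].
Qed.

End Tree.

Record simplex (T : finType) (q t : nat) := Simplex {
  sa : 'I_q -> T;
  sb : 'I_t -> T;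
  sa_inj : injective sa;
  sb_inj : injective sb;
  sab_neq : forall j i, sa j != sb i
}.

Record normalized_load (R : realFieldType) (q t : nat) := NormalizedLoad {
  la : 'I_q -> R;
  lb : 'I_t -> R;
  la_gt0 : forall j, 0 < la j;
  lb_gt0 : forall i, 0 < lb i;
  la_sum : \sum_j la j = 1;
  lb_sum : \sum_i lb i = 1
}.

Section Generic.
Variables (R : realFieldType) (T : metric_tree R) (q t : nat).
Variable D : simplex T q t.
Implicit Types (u v l x y : T).

Definition side_a : {set T} := [set sa D j | j : 'I_q].
Definition side_b : {set T} := [set sb D i | i : 'I_t].
Definition vertices : {set T} := side_a :|: side_b.

Definition same_parity u v : bool :=
  (u \in side_a) && (v \in side_a) || (u \in side_b) && (v \in side_b).

Definition opposite_parity u v : bool :=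
  (u \in side_a) && (v \in side_b) || (u \in side_b) && (v \in side_a).

(* vertex set of the minimal subtree T_D *)
Definition hull : {set T} :=
  \bigcup_(x in vertices) \bigcup_(y in vertices) geodesic x y.

Definition generically_labeled : Prop :=
  vertices = hull /\
  forall x y, x \in hull -> y \in hull -> adj x y -> opposite_parity x y.

Section Weights.
Variables (l : T) (delta : R).

(* The recursive assignment of weights away from the root; k bounds the
   recursion depth, and any bound exceeding the height of v gives the weight of
   v (see [generic_weightE]). *)
Fixpoint generic_rec (k : nat) (v : T) : R :=
  if k is k'.+1 then
    \sum_(u in descendants l v | opposite_parity u v) generic_rec k' u
    - \sum_(u in descendants l v :\ v | same_parity u v) generic_rec k' u
    + delta / elen (parent_edge l v)
  else 0.

Definition generic_weight (v : T) : R :=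
  if v == l then
    1 - \sum_(u | (u != l) && same_parity u l) generic_rec #|T| u
  else generic_rec #|T| v.

Lemma opposite_parity_irr v : opposite_parity v v = false.
Proof.
rewrite /opposite_parity [X in _ || X]andbC orbb.
apply/negP => /andP[/imsetP[j _ ->] /imsetP[i _]].
by apply/eqP/sab_neq.
Qed.

Lemma generic_rec_stable k k' v :
  (#|T| <= size (tree_path v l) + k)%N -> (#|T| <= size (tree_path v l) + k')%N ->
  generic_rec k v = generic_rec k' v.
Proof.
elim: k k' v => [|k IHk] [|k'] v //= Hk Hk'; have Hv := size_tree_path v l.
- by move: Hk; rewrite addn0 leqNgt Hv.
- by move: Hk'; rewrite addn0 leqNgt Hv.
have IH u : u \in descendants l v -> u != v ->
    generic_rec k u = generic_rec k' u.
  move=> uv nuv; have Hs := descendants_size uv nuv.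
  by apply: IHk; [apply: leq_trans Hk _ | apply: leq_trans Hk' _];
     rewrite addnS -addSn leq_add2r.
congr (_ - _ + _); apply: eq_bigr => u.
  case/andP=> uv op; apply: IH => //.
  by apply: contraTneq op => ->; rewrite opposite_parity_irr.
by case/andP=> /setD1P[nuv uv] _; apply: IH.
Qed.

Lemma descendants_root v : v != l -> l \notin descendants l v.
Proof.
move=> nvl; apply/negP => /descendants_size; rewrite eq_sym => /(_ nvl).
by rewrite (@tree_pathE _ _ l l [::]) // /simple_path /= eqxx.
Qed.

Lemma generic_weightE v : v != l ->
  generic_weight v =
    \sum_(u in descendants l v | opposite_parity u v) generic_weight u
    - \sum_(u in descendants l v :\ v | same_parity u v) generic_weight u
    + delta / elen (parent_edge l v).
Proof.
move=> nvl; have Hl := descendants_root nvl.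
rewrite {1}/generic_weight (negPf nvl) (@generic_rec_stable _ #|T|.+1) /=;
  rewrite ?leq_addl ?(leqW (leq_addl _ _)) ?(leq_trans (leqnSn _) (leq_addl _ _)) //.
congr (_ - _ + _); apply: eq_bigr => u /andP[Hu _].
  by rewrite /generic_weight ifN //; apply: contraNneq Hl => e; rewrite -{1}e.
case/setD1P: Hu => _ Hu.
by rewrite /generic_weight ifN //; apply: contraNneq Hl => e; rewrite -{1}e.
Qed.

Lemma generic_weight_root :
  generic_weight l = 1 - \sum_(u | (u != l) && same_parity u l) generic_weight u.
Proof.
rewrite {1}/generic_weight eqxx; congr (1 - _); apply: eq_bigr => u /andP[nul _].
by rewrite /generic_weight ifN.
Qed.

End Weights.

Definition generically_weighted (l : T) (w : normalized_load R q t) : Prop :=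
  (forall j, la w j = generic_weight l (generic_delta T) (sa D j)) /\
  (forall i, lb w i = generic_weight l (generic_delta T) (sb D i)).

End Generic.

(* Main.v *)
Require Import Defs.
From mathcomp Require Import all_boot all_order all_algebra.
From mathcomp Require Import ring lra.

(** Root the tree at a vertex [l].  Each vertex [v] other than [l] stands for
    the edge [e v] joining it to its parent, and this edge cuts the tree into
    the descendants of [v] and the rest.  A geodesic crosses that edge exactly
    when it joins the two sides of the cut, so the distance is a sum of cut
    pseudometrics ([dist_cuts]).

    Let the charge be the load on side [a] minus the load on side [b]; it has
    total 0.  Let [S v] ([cut_mass]) be the charge of the descendants of [v].
    Expanding the distances over the cuts turns the gap (cross terms minus
    internal terms) into the energy of a flow, the sum over [v] of
    [|e v| * S v ^ 2] ([gap_cuts]).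

    Half the parity function, which is 1/2 on side [a], -1/2 on side [b] and 0
    elsewhere, pairs with the charge to 1.  Let [c v] ([slope]) be its
    difference along [e v]; summation by parts ([sum_by_parts]) gives
    [sum c v * S v = 1], and [|c v| <= 1].  Cauchy-Schwarz now bounds the energy below by
    [d = (sum |e v|^-1)^-1].  In the exact form used here ([cauchy_defect]) the
    difference between the gap and [d] is
      [sum |e v| * (S v - d * c v / |e v|) ^ 2 + d ^ 2 * (1 - c v ^ 2) / |e v|],
    which is a sum of nonnegative terms.

    Equality therefore means two things.  First, [c v ^ 2 = 1] at every edge:
    the ends of every edge have opposite parity, which is the generic labeling
    of the whole tree ([opposite_parents]).  Secondly, [S v = d * c v / |e v|];
    solved for the load of [v], this is the recursive step of the generic
    algorithm ([cut_mass_generic_step]), and that recursion together with the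
    normalization determines the load ([generically_weighted_generic_step]). *)

Set Implicit Arguments.
Unset Strict Implicit.
Unset Printing Implicit Defensive.

Import Order.TTheory GRing.Theory Num.Theory.
Local Open Scope ring_scope.

(** * Geodesics *)

Section Geodesics.
Variables (R : realFieldType) (T : metric_tree R).
Implicit Types (u v w x y z : T).

Lemma adj_irr x : adj x x = false.
Proof. by apply/negP => /card_edge; rewrite setUid cards1. Qed.

Lemma tree_path_nil x : tree_path x x = [::].
Proof. by apply: tree_pathE; rewrite /simple_path /= eqxx. Qed.

Lemma geodesic_left x y : x \in geodesic x y.
Proof. by rewrite inE mem_head. Qed.

(** A walk is shortened to a simple path by cutting out loops, and in a tree
    that simple path is the geodesic.  Hence a vertex of the geodesic cannot be
    avoided by any walk between its ends. *)
Lemma geodesic_sub_walk x p :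
  path (@adj R T) x p -> {subset geodesic x (last x p) <= x :: p}.
Proof.
move=> Hp z; case: (shortenP Hp) => p' Hp' Up' sub.
rewrite inE (@tree_pathE _ _ _ _ p'); last by apply/and3P.
by rewrite !inE => /orP[->//|/sub ->]; rewrite orbT.
Qed.

Lemma geodesic_sym x y : geodesic x y = geodesic y x.
Proof.
suff sub u v z : z \in geodesic u v -> z \in geodesic v u.
  by apply/setP => z; apply/idP/idP; apply: sub.
case/and3P: (tree_pathP v u) => Hp /eqP Hl _.
have Hw : path (@adj R T) u (rev (belast v (tree_path v u))).
  rewrite -{1}Hl rev_path.
  by apply: sub_path Hp => a b; rewrite /= adj_sym.
have Ew : u :: rev (belast v (tree_path v u)) = rev (v :: tree_path v u).
  by rewrite [in RHS]lastI rev_rcons Hl.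
have Elast : last u (rev (belast v (tree_path v u))) = v.
  by rewrite -[last _ _]/(last u (u :: _)) Ew rev_cons last_rcons.
have := @geodesic_sub_walk u _ Hw z.
by rewrite Elast Ew mem_rev [z \in geodesic v u]inE.
Qed.

Lemma geodesic_via y x z v :
  v \in geodesic x z -> (v \in geodesic x y) || (v \in geodesic y z).
Proof.
case/and3P: (tree_pathP x y) => Hp /eqP Hl _.
case/and3P: (tree_pathP y z) => Hq /eqP Hm _.
have Hw : path (@adj R T) x (tree_path x y ++ tree_path y z).
  by rewrite cat_path Hp Hl.
have := @geodesic_sub_walk x _ Hw v; rewrite last_cat Hl Hm => H /H.
by rewrite !inE mem_cat => /or3P[|->|->]; rewrite ?orbT // => ->.
Qed.

Lemma tree_path_consE x y z p :
  tree_path x y = z :: p -> adj x z /\ p = tree_path z y.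
Proof.
move=> E; have := tree_pathP x y; rewrite E => H; split.
  by case/and3P: H => /= /andP[].
by rewrite (tree_pathE (simple_path_behead H)).
Qed.

Lemma tree_path_cons_notin x y z :
  tree_path x y = z :: tree_path z y -> x \notin geodesic z y.
Proof.
by move=> E; case/and3P: (tree_pathP x y) => _ _; rewrite E in_set => /andP[].
Qed.

(** Of the two ends of an edge, exactly one is on the way from the other to
    [y]: this is the orientation of the edge towards [y]. *)
Lemma tree_path_adj x z y : adj x z ->
  tree_path x y = z :: tree_path z y \/ tree_path z y = x :: tree_path x y.
Proof.
move=> xz; have [|nx] := boolP (x \in geodesic z y); last first.
  left; apply: tree_pathE; case/and3P: (tree_pathP z y) => Hp Hl Up.
  apply/and3P; split; rewrite /= ?xz //.
  by move: nx; rewrite inE => ->.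
rewrite inE in_cons; case/orP => [/eqP e|Hx]; first by rewrite e adj_irr in xz.
right; have := tree_pathP z y; case: (path.splitP Hx) => p1 p2 H.
case/and3P: H; rewrite cat_path last_cat last_rcons -cat_cons cat_uniq.
case/andP=> Hp1 Hp2 Hl /and3P[U1 /hasPn H12 U2].
(* [x] is adjacent to [z], so the initial segment from [z] to [x] is the edge
   itself. *)
have E1 : rcons p1 x = [:: x].
  apply: (@simple_path_inj _ _ z x); apply/and3P.
    by rewrite last_rcons eqxx.
  rewrite /= adj_sym xz inE eqxx !andbT; split=> //.
  by apply: contraTneq xz => ->; rewrite adj_irr.
rewrite E1 /= (@tree_pathE _ _ x y p2) //; apply/and3P; split=> //=.
rewrite U2 andbT; apply/negP => /H12.
by rewrite /= inE mem_rcons mem_head orbT.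
Qed.

Lemma tree_path_cons_in x z y : adj x z ->
  tree_path x y = z :: tree_path z y <-> z \in geodesic x y.
Proof.
move=> xz; split=> [E|]; first by rewrite in_set E !in_cons eqxx orbT.
case: (tree_path_adj y xz) => // E.
by rewrite (negPf (tree_path_cons_notin E)).
Qed.

Lemma dist_cons x y z :
  tree_path x y = z :: tree_path z y -> dist x y = elen [set x; z] + dist z y.
Proof. by rewrite /dist => ->; rewrite /= big_cons. Qed.

Lemma dist_refl x : dist x x = 0.
Proof. by rewrite /dist tree_path_nil big_nil. Qed.

End Geodesics.

(** * The rooted tree *)

Section Rooted.
Variables (R : realFieldType) (T : metric_tree R) (l : T).
Implicit Types (u v w x y z : T).

Lemma parentP v : v != l ->
  adj v (parent l v) /\ tree_path v l = parent l v :: tree_path (parent l v) l.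
Proof.
move=> nvl; rewrite /parent; case: pickP => [y /andP[vy lt_yv]|none] /=.
  split=> //; case: (tree_path_adj l vy) => // E; exfalso.
  by move: lt_yv; rewrite (dist_cons E) setUC gtrDr ltNge ltW ?elen_gt0.
case E: (tree_path v l) => [|y p].
  case/and3P: (tree_pathP v l); rewrite E /= => _ vl _.
  by rewrite vl in nvl.
case: (tree_path_consE E) => vy Ep; exfalso; rewrite Ep in E.
by have := none y; rewrite vy (dist_cons E) ltrDr elen_gt0.
Qed.

Lemma parent_edge_in v : v != l -> parent_edge l v \in edges T.
Proof. by case/parentP. Qed.

Lemma rooted_ind (P : T -> Prop) :
  P l -> (forall v, v != l -> P (parent l v) -> P v) -> forall v, P v.
Proof.
move=> Pl Pp v; have [n] := ubnP (size (tree_path v l)).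
elim: n v => // n IHn v; have [->//|nvl] := eqVneq v l.
by have [_ ->] := parentP nvl; move=> /= lt_n; apply: Pp => //; apply: IHn.
Qed.

Lemma adj_parent x z : adj x z ->
  (x != l /\ parent l x = z) \/ (z != l /\ parent l z = x).
Proof.
have nl a b p : tree_path a l = b :: p -> a != l.
  by move=> E; apply: contra_eq_neq E => ->; rewrite tree_path_nil.
have main a b : tree_path a l = b :: tree_path b l -> a != l /\ parent l a = b.
  by move=> E; have na := nl _ _ _ E; have [_] := parentP na; rewrite E => -[].
by move=> /(tree_path_adj l)[/main|/main]; [left|right].
Qed.

Lemma parentK_neq v : v != l -> parent l v != l -> parent l (parent l v) != v.
Proof.
move=> nv np; apply/eqP => E.
have [_ E1] := parentP nv; have [_ E2] := parentP np; rewrite E in E2.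
by have := congr1 size E1; rewrite E2 /= => /eqP; rewrite ltn_eqF.
Qed.

(** Every edge points towards the root from exactly one of its ends, so sums
    over edges become sums over the vertices other than [l]. *)
Lemma edges_parent :
  edges T = [set parent_edge l v | v in [pred v | v != l]].
Proof.
apply/setP => e; apply/idP/imsetP => [He|[v nv ->]]; last exact: parent_edge_in.
have /cards2P[x [z [_ Ee]]] := introT eqP (card_edge He); rewrite {}Ee in He *.
case: (adj_parent (He : adj x z)) => -[n p]; [exists x | exists z] => //.
  by rewrite /parent_edge p.
by rewrite /parent_edge p setUC.
Qed.

Lemma parent_edge_inj : {in [pred v | v != l] &, injective (parent_edge l)}.
Proof.
move=> v w; rewrite !inE => nv nw E; apply/eqP; apply/negPn/negP => nvw.
have vw : v \in [set w; parent l w] by rewrite -[[set _; _]]E set21.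
have wv : w \in [set v; parent l v] by rewrite [[set _; _]]E set21.
move: vw wv; rewrite !in_set2 (eq_sym w) (negPf nvw) /= => /eqP vw /eqP wv.
by have := parentK_neq nv; rewrite -wv -vw nw eqxx => /(_ isT).
Qed.

Lemma sum_edges (F : {set T} -> R) :
  \sum_(e in edges T) F e = \sum_(v | v != l) F (parent_edge l v).
Proof. by rewrite edges_parent big_imset //; apply: parent_edge_inj. Qed.

Lemma geodesic_parent u w : u != l ->
  (w \in geodesic u l) = (w == u) || (w \in geodesic (parent l u) l).
Proof.
by move=> nu; have [_ E] := parentP nu; rewrite inE E in_cons [in RHS]inE.
Qed.

Lemma parent_notin_descendants v : v != l -> parent l v \notin descendants l v.
Proof.
by move=> nv; have [_ E] := parentP nv; rewrite inE (tree_path_cons_notin E).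
Qed.

Lemma in_descendants_self v : v \in descendants l v.
Proof. by rewrite inE geodesic_left. Qed.

Lemma in_descendants_parent u v : u != l -> v != u ->
  (u \in descendants l v) = (parent l u \in descendants l v).
Proof.
move=> nu nvu; rewrite 2![in RHS]inE inE.
by rewrite geodesic_parent // (negPf nvu) inE.
Qed.

(** The root and the parent of [v] lie on the same side of [v], so [v] separates
    a vertex from the one exactly when it separates it from the other. *)
Lemma descendants_through u v : v != l ->
  (u \in descendants l v) = (v \in geodesic (parent l v) u).
Proof.
move=> nv; have := parent_notin_descendants nv.
rewrite ![_ \in descendants _ _]in_set => /negPf np.
rewrite [in RHS]geodesic_sym; apply/idP/idP.
  by move/(geodesic_via (parent l v)); rewrite np orbF.
by move/(geodesic_via l); rewrite [geodesic l _]geodesic_sym np orbF.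
Qed.

(** Induction along the geodesic.  Its first edge [{x, z}] is the parent edge of
    one of its ends [c]: only the cut at [c] distinguishes [x] from [z], and it
    does so with [z] on the side of [y]. *)
Lemma dist_cuts x y :
  dist x y = \sum_(v | v != l) elen (parent_edge l v) *
    ((x \in descendants l v) (+) (y \in descendants l v))%:R.
Proof.
move E : (tree_path x y) => p; elim: p x E => [|z p IHp] x E.
  case/and3P: (tree_pathP x y); rewrite E /= => _ /eqP <- _.
  rewrite dist_refl big1 // => v _; by rewrite addbb mulr0.
have [xz Ep] := tree_path_consE E; rewrite {}Ep in E IHp.
rewrite (dist_cons E) IHp //.
have step c : c != l -> parent_edge l c = [set x; z] ->
    (x \in descendants l c) (+) (y \in descendants l c) ->
    ~~ ((z \in descendants l c) (+) (y \in descendants l c)) ->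
    (forall v, v != c -> (x \in descendants l v) = (z \in descendants l v)) ->
    elen [set x; z] + \sum_(v | v != l) elen (parent_edge l v) *
      ((z \in descendants l v) (+) (y \in descendants l v))%:R =
    \sum_(v | v != l) elen (parent_edge l v) *
      ((x \in descendants l v) (+) (y \in descendants l v))%:R.
  move=> nc Ec xy /negPf zy H.
  rewrite (bigD1 c) //= [RHS](bigD1 c) //= xy zy Ec mulr1 mulr0 add0r.
  by congr (_ + _); apply: eq_bigr => v /andP[_ /H ->].
case: (adj_parent xz) => -[nc Ec].
  apply: (step x); rewrite ?/parent_edge ?Ec //.
  - by rewrite in_descendants_self descendants_through // Ec
               (negPf (tree_path_cons_notin E)).
  - rewrite -{1}Ec (negPf (parent_notin_descendants nc)) descendants_through //.
    by rewrite Ec (negPf (tree_path_cons_notin E)).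
  - by move=> v nv; rewrite in_descendants_parent ?Ec.
have zy : y \in descendants l z.
  by rewrite descendants_through // Ec; apply/tree_path_cons_in.
apply: (step z); rewrite ?/parent_edge ?Ec ?zy ?in_descendants_self //.
- by rewrite setUC.
- by rewrite -Ec (negPf (parent_notin_descendants nc)).
- by move=> v nv; rewrite [RHS]in_descendants_parent ?Ec.
Qed.

(** The vertices that have [u] as a descendant are those on the way from [u] to
    the root, and consecutive differences along that way telescope. *)
Lemma telescope_to_root (f : T -> R) u :
  \sum_(v | (v != l) && (u \in descendants l v)) (f v - f (parent l v)) =
  f u - f l.
Proof.
elim/rooted_ind: u => [|u nu IH].
  rewrite subrr big_pred0 // => v; case: eqVneq => //= nv.
  exact/negbTE/descendants_root.
rewrite (bigD1 u) /=; last by rewrite nu in_descendants_self.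
rewrite -[RHS](subrKA (f (parent l u))) -IH; congr (_ + _); apply: eq_bigl => v.
case: (eqVneq v u) => [->|nvu] /=; last by rewrite andbT in_descendants_parent.
by rewrite andbF (negPf (parent_notin_descendants nu)) andbF.
Qed.

(** * Cuts, summation by parts and energy *)

Definition cut_mass (s : T -> R) v : R := \sum_(u in descendants l v) s u.

(** The boundary term is [f l] times the total of [s], hence 0. *)
Lemma sum_by_parts (f s : T -> R) : \sum_u s u = 0 ->
  \sum_(v | v != l) (f v - f (parent l v)) * cut_mass s v = \sum_u f u * s u.
Proof.
move=> s0; under eq_bigr do rewrite /cut_mass mulr_sumr.
rewrite (exchange_big_dep predT) //=.
transitivity (\sum_u (f u - f l) * s u).
  by apply: eq_bigr => u _; rewrite -mulr_suml telescope_to_root.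
transitivity (\sum_u (f u * s u - f l * s u)).
  by apply: eq_bigr => u _; rewrite mulrBl.
by rewrite sumrB -mulr_sumr s0 mulr0 subr0.
Qed.

(** Reading [m] and [n] as the laws of two independent points, the factor of
    each edge is the probability that its cut separates them. *)
Lemma dist_form (m n : T -> R) : \sum_u m u = 1 -> \sum_u n u = 1 ->
  \sum_x \sum_y m x * n y * dist x y =
  \sum_(v | v != l) elen (parent_edge l v) *
    (cut_mass m v * (1 - cut_mass n v) + (1 - cut_mass m v) * cut_mass n v).
Proof.
move=> m1 n1.
have split_mass (s : T -> R) v : \sum_u s u = 1 ->
    1 - cut_mass s v = \sum_(u | u \notin descendants l v) s u.
  by move=> <-; rewrite /cut_mass (bigID (mem (descendants l v))) /= addrC addrK.
under eq_bigr => x _.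
  under eq_bigr do rewrite dist_cuts mulr_sumr.
  rewrite exchange_big /=; over.
rewrite exchange_big /=; apply: eq_bigr => v _.
rewrite !split_mass // /cut_mass !big_distrlr /=.
rewrite [\sum_(x in descendants l v) _]big_mkcond.
rewrite [\sum_(x | x \notin descendants l v) _]big_mkcond /= -big_split mulr_sumr.
apply: eq_bigr => x _ /=; case: ifP => xv; rewrite /= ?addr0 ?add0r.
  rewrite [in RHS]big_mkcond mulr_sumr; apply: eq_bigr => y _.
  by case: ifP => //=; rewrite ?mulr0 // mulr1 mulrC.
rewrite [in RHS]big_mkcond mulr_sumr; apply: eq_bigr => y _.
by case: ifP => //=; rewrite ?mulr0 // mulr1 mulrC.
Qed.

(** With [a] and [b] the masses of one side of a cut, the identity for that cut
    reads [a (1 - b) + (1 - a) b - a (1 - a) - b (1 - b) = (a - b) ^ 2]. *)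
Lemma energy_cuts (m n : T -> R) : \sum_u m u = 1 -> \sum_u n u = 1 ->
  \sum_x \sum_y m x * n y * dist x y
  - (\sum_x \sum_y m x * m y * dist x y) / 2
  - (\sum_x \sum_y n x * n y * dist x y) / 2 =
  \sum_(v | v != l)
    elen (parent_edge l v) * cut_mass (fun u => m u - n u) v ^+ 2.
Proof.
move=> m1 n1; rewrite !dist_form // !mulr_suml -!sumrB; apply: eq_bigr => v _.
by rewrite /cut_mass sumrB -/(cut_mass m v) -/(cut_mass n v); field.
Qed.

End Rooted.

(** * The Cauchy-Schwarz defect *)

(** Expanding the square gives the identity, because [sum c S = 1] and
    [d ^ 2 * sum 1 / k = d]; with [c ^ 2 <= 1] it contains both the bound by [d]
    and its equality case.  The sum of the [1 / k] is positive because an empty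
    index set would contradict [sum c S = 1]. *)
Lemma cauchy_defect (R : realFieldType) (I : finType) (P : pred I)
    (k S c : I -> R) :
  (forall i, P i -> 0 < k i) -> \sum_(i | P i) c i * S i = 1 ->
  let d := (\sum_(i | P i) (k i)^-1)^-1 in
  0 < d /\
  \sum_(i | P i) k i * S i ^+ 2 - d =
  \sum_(i | P i) (k i * (S i - d * c i / k i) ^+ 2
                  + d ^+ 2 * (1 - c i ^+ 2) / k i).
Proof.
move=> k0 cS d.
have d0 : 0 < d.
  have kV_ge0 i : P i -> 0 <= (k i)^-1 by move=> /k0; rewrite invr_ge0 => /ltW.
  rewrite invr_gt0 lt_neqAle sumr_ge0 // andbT eq_sym; apply/eqP => /psumr_eq0P E.
  move: cS; rewrite big_pred0 => [/eqP|i]; first by rewrite eq_sym oner_eq0.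
  apply/negbTE/negP => Pi; have := E kV_ge0 i Pi; move/eqP.
  by rewrite invr_eq0 gt_eqF ?k0.
split=> //.
transitivity (\sum_(i | P i) (k i * S i ^+ 2 - 2 * d * (c i * S i)
   + d ^+ 2 * (k i)^-1)).
  rewrite big_split sumrB /= -!mulr_sumr cS mulr1 -addrA; congr (_ + _).
  rewrite -[X in _ + _ * X]invrK -/d expr2 mulfK ?gt_eqF //; ring.
by apply: eq_bigr => i /k0 /lt0r_neq0 ki; field.
Qed.

(** * Pushing loads forward to the vertices *)

Lemma sum_ltn_half (R : realFieldType) (n : nat) (G : 'I_n -> 'I_n -> R) :
  (forall i j, G i j = G j i) -> (forall i, G i i = 0) ->
  \sum_(i < n) \sum_(j < n | (i < j)%N) G i j = (\sum_i \sum_j G i j) / 2.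
Proof.
move=> Gsym G0.
have -> : \sum_i \sum_j G i j =
    \sum_(i < n) \sum_(j < n | (i < j)%N) G i j +
    \sum_(i < n) \sum_(j < n | (j < i)%N) G i j.
  rewrite -big_split; apply: eq_bigr => i _ /=.
  rewrite (bigID (fun j : 'I_n => (i < j)%N)) /=; congr (_ + _).
  rewrite (bigD1 i) /= ?ltnn // G0 add0r; apply: eq_bigl => j.
  by rewrite -leqNgt [in RHS]ltn_neqAle andbC.
have -> : \sum_(i < n) \sum_(j < n | (j < i)%N) G i j =
    \sum_(i < n) \sum_(j < n | (i < j)%N) G i j.
  rewrite (exchange_big_dep predT) //=.
  by apply: eq_bigr => j _; apply: eq_bigr => i _.
by field.
Qed.

Section Mass.
Variables (R : realFieldType) (T : finType) (n : nat).
Variables (f : 'I_n -> T) (m : 'I_n -> R).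

Definition mass (u : T) : R := \sum_(j | f j == u) m j.

Lemma sum_mass (F : T -> R) : \sum_u mass u * F u = \sum_j m j * F (f j).
Proof.
rewrite [RHS](partition_big f predT) //=; apply: eq_bigr => u _.
by rewrite mulr_suml; apply: eq_bigr => j /eqP ->.
Qed.

Lemma total_mass : \sum_u mass u = \sum_j m j.
Proof. by rewrite [RHS](partition_big f predT). Qed.

Lemma mass_inj j : injective f -> mass (f j) = m j.
Proof. by move=> f_inj; rewrite /mass (big_pred1 j) // => i; apply: inj_eq. Qed.

Lemma mass_out u : u \notin [set f j | j : 'I_n] -> mass u = 0.
Proof.
move=> nu; rewrite /mass big_pred0 // => j.
by apply: contraNF nu => /eqP <-; apply: imset_f.
Qed.

End Mass.

Lemma sum_mass2 (R : realFieldType) (T : finType) p n (f : 'I_p -> T)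
    (g : 'I_n -> T) (a : 'I_p -> R) (b : 'I_n -> R) (F : T -> T -> R) :
  \sum_u \sum_v mass f a u * mass g b v * F u v =
  \sum_j \sum_i a j * b i * F (f j) (g i).
Proof.
transitivity (\sum_u mass f a u * \sum_i b i * F u (g i)).
  apply: eq_bigr => u _; rewrite -sum_mass mulr_sumr.
  by apply: eq_bigr => v _; rewrite mulrA.
rewrite sum_mass; apply: eq_bigr => j _; rewrite mulr_sumr.
by apply: eq_bigr => i _; rewrite mulrA.
Qed.

Lemma dist_sym (R : realFieldType) (T : metric_tree R) (x y : T) :
  dist x y = dist y x.
Proof. by rewrite !(dist_cuts x); apply: eq_bigr => v _; rewrite addbC. Qed.

(** * The gap of a normalized simplex *)

Section Gap.
Variables (R : realFieldType) (T : metric_tree R) (q t : nat).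
Variables (D : simplex T q t) (w : normalized_load R q t).
Implicit Types (u v l x y : T).

Definition charge u : R := mass (sa D) (la w) u - mass (sb D) (lb w) u.
Definition load u : R := mass (sa D) (la w) u + mass (sb D) (lb w) u.
Definition parity u : R := (u \in side_a D)%:R - (u \in side_b D)%:R.

Definition gap : R :=
  \sum_j \sum_i la w j * lb w i * dist (sa D j) (sb D i)
  - \sum_(j1 < q) \sum_(j2 < q | (j1 < j2)%N)
      la w j1 * la w j2 * dist (sa D j1) (sa D j2)
  - \sum_(i1 < t) \sum_(i2 < t | (i1 < i2)%N)
      lb w i1 * lb w i2 * dist (sb D i1) (sb D i2).

Lemma gap_cuts l :
  gap = \sum_(v | v != l) elen (parent_edge l v) * cut_mass l charge v ^+ 2.
Proof.
rewrite -energy_cuts ?total_mass ?la_sum ?lb_sum // !sum_mass2 /gap.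
rewrite !sum_ltn_half // => i *; rewrite ?dist_refl ?mulr0 //.
  by rewrite dist_sym [lb w i * _]mulrC.
by rewrite dist_sym [la w i * _]mulrC.
Qed.

Lemma side_disjoint u : ~~ ((u \in side_a D) && (u \in side_b D)).
Proof.
apply/negP => /andP[/imsetP[j _ ->] /imsetP[i _] /eqP].
exact/negP/sab_neq.
Qed.

Lemma parity_a j : parity (sa D j) = 1.
Proof.
have aj : sa D j \in side_a D by apply: imset_f.
by have := side_disjoint (sa D j); rewrite /parity aj /= => /negPf ->; rewrite subr0.
Qed.

Lemma parity_b i : parity (sb D i) = -1.
Proof.
have bi : sb D i \in side_b D by apply: imset_f.
have := side_disjoint (sb D i); rewrite /parity bi andbT => /negPf ->.
by rewrite sub0r.
Qed.

Lemma charge_total : \sum_u charge u = 0.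
Proof. by rewrite sumrB !total_mass la_sum lb_sum subrr. Qed.

(** The loads on the two sides contribute 1/2 each. *)
Lemma charge_parity : \sum_u parity u / 2 * charge u = 1.
Proof.
transitivity (\sum_u mass (sa D) (la w) u * (parity u / 2)
   - \sum_u mass (sb D) (lb w) u * (parity u / 2)).
  by rewrite -sumrB; apply: eq_bigr => u _; rewrite /charge; ring.
rewrite !sum_mass; under eq_bigr do rewrite parity_a.
under [X in _ - X]eq_bigr do rewrite parity_b.
by rewrite -!mulr_suml la_sum lb_sum; field.
Qed.

Definition slope l v : R := (parity v - parity (parent l v)) / 2.

(** The flow carried by the parent edge of [v] at the minimum of the energy,
    signed like the charge below [v]. *)
Definition optimal_flow l v : R :=
  generic_delta T * slope l v / elen (parent_edge l v).

Lemma slope_charge l : \sum_(v | v != l) slope l v * cut_mass l charge v = 1.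
Proof.
rewrite -charge_parity -(sum_by_parts l _ charge_total).
by apply: eq_bigr => v _; rewrite /slope mulrBl.
Qed.

Lemma opposite_parityC u v : opposite_parity D u v = opposite_parity D v u.
Proof. by rewrite /opposite_parity orbC andbC [X in _ || X]andbC. Qed.

(** Parity takes values in {-1, 0, 1}, so half a difference has absolute value
    1 only between 1 and -1. *)
Lemma opposite_parity_sq u v :
  ((parity u - parity v) / 2) ^+ 2 <= 1 ?= iff opposite_parity D u v.
Proof.
have := side_disjoint u; have := side_disjoint v.
rewrite /opposite_parity /parity.
case: (u \in side_a D); case: (u \in side_b D); case: (v \in side_a D);
  case: (v \in side_b D) => //= _ _; split;
  first [lra | apply/eqP; lra].
Qed.

Lemma gap_defect l :
  0 < generic_delta T /\
  gap - generic_delta T =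
  \sum_(v | v != l) (elen (parent_edge l v) *
      (cut_mass l charge v - optimal_flow l v) ^+ 2
    + generic_delta T ^+ 2 * (1 - slope l v ^+ 2) / elen (parent_edge l v)).
Proof.
rewrite (gap_cuts l) /optimal_flow /generic_delta (sum_edges l).
apply: cauchy_defect.
  by move=> v nv; apply/elen_gt0/parent_edge_in.
exact: slope_charge.
Qed.

Lemma gap_defect_terms_ge0 l v : v != l ->
  0 <= elen (parent_edge l v) *
      (cut_mass l charge v - optimal_flow l v) ^+ 2
    + generic_delta T ^+ 2 * (1 - slope l v ^+ 2) / elen (parent_edge l v)
    ?= iff opposite_parity D v (parent l v) &&
      (cut_mass l charge v == optimal_flow l v).
Proof.
move=> nv; have e0 := elen_gt0 (parent_edge_in nv); have [d0 _] := gap_defect l.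
have [c1 cE] := opposite_parity_sq v (parent l v).
rewrite -/(slope l v) in c1 cE.
have A0 : 0 <=
    elen (parent_edge l v) * (cut_mass l charge v - optimal_flow l v) ^+ 2.
  by rewrite mulr_ge0 ?sqr_ge0 // ltW.
have B0 : 0 <=
    generic_delta T ^+ 2 * (1 - slope l v ^+ 2) / elen (parent_edge l v).
  by rewrite divr_ge0 ?mulr_ge0 ?sqr_ge0 ?subr_ge0 // ltW.
split; first exact: addr_ge0.
have eV0 : 0 < (elen (parent_edge l v))^-1 by rewrite invr_gt0.
rewrite eq_sym paddr_eq0 // !mulf_eq0 (gt_eqF e0) (gt_eqF d0) (gt_eqF eV0) /=.
by rewrite orbF orbb !subr_eq0 [1 == _]eq_sym cE andbC.
Qed.

(** The terms of [gap_defect] are nonnegative, so their sum vanishes only if each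
    of them does; this holds for any choice of the root. *)
Lemma gap_ge_delta l :
  generic_delta T <= gap ?= iff [forall (v | v != l),
    opposite_parity D v (parent l v) &&
      (cut_mass l charge v == optimal_flow l v)].
Proof.
have H := leif_sum (fun v nv => @gap_defect_terms_ge0 l v nv).
have [_ E] := gap_defect l; rewrite -E big1 // in H.
by case: H; rewrite subr_ge0 eq_sym subr_eq0 eq_sym; split.
Qed.

End Gap.

(** * The case of equality *)

Section Equality.
Variables (R : realFieldType) (T : metric_tree R) (q t : nat).
Variables (D : simplex T q t) (w : normalized_load R q t).
Implicit Types (u v l x y : T).

(** Opposite parity across the edges puts both ends of every edge in the
    simplex; the root is reached too because the tree has a second vertex. *)
Lemma opposite_parents (hq : (0 < q)%N) (ht : (0 < t)%N) l :
  (forall v, v != l -> opposite_parity D v (parent l v)) <->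
  vertices D = [set: T] /\ generically_labeled D.
Proof.
have opp_in x y : opposite_parity D x y -> x \in vertices D.
  by rewrite /opposite_parity inE => /orP[] /andP[->]; rewrite ?orbT.
split=> [opp|[DT [hT Hedge]] v nv]; last first.
  by have [vp _] := parentP nv; apply: Hedge; rewrite -?hT ?DT ?inE.
have [u nu] : exists u, u != l.
  have := sab_neq D (Ordinal hq) (Ordinal ht).
  case: (eqVneq (sa D (Ordinal hq)) l).
    by move=> -> nb; exists (sb D (Ordinal ht)); rewrite eq_sym.
  by move=> na _; exists (sa D (Ordinal hq)).
have opp_adj x y : adj x y -> opposite_parity D x y.
  case/(adj_parent l) => -[n <-]; first exact: opp.
  by rewrite opposite_parityC; apply: opp.
have DT : vertices D = [set: T].
  apply/setP => v; rewrite [RHS]inE; have [->|/opp/opp_in //] := eqVneq v l.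
  case E: (tree_path l u) => [|z p].
    by case/and3P: (tree_pathP l u); rewrite E /= eq_sym (negPf nu).
  by have [/opp_adj/opp_in] := tree_path_consE E.
split=> //; split=> [|x y _ _ /opp_adj //].
apply/eqP; rewrite eqEsubset {2}DT subsetT andbT; apply/subsetP => x xD.
apply/bigcupP; exists x => //; apply/bigcupP; exists x => //.
exact: geodesic_left.
Qed.

(** Right-hand side of the recursive rule of the generic algorithm, for an
    arbitrary weight function. *)
Definition generic_step l (g : T -> R) v :=
  \sum_(u in descendants l v | opposite_parity D u v) g u
  - \sum_(u in descendants l v :\ v | same_parity D u v) g u
  + generic_delta T / elen (parent_edge l v).

(** Off the root the rule determines the weights: it only involves proper
    descendants, which are farther from the root. *)
Lemma generic_step_unique l (g h : T -> R) :
  (forall v, v != l -> g v = generic_step l g v) ->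
  (forall v, v != l -> h v = generic_step l h v) ->
  forall v, v != l -> g v = h v.
Proof.
move=> gE hE v; have [n] := ubnP (#|T| - size (tree_path v l)).
elim: n v => // n IHn v; rewrite ltnS => lt_n nv; rewrite gE // hE //.
have IH u : u \in descendants l v -> u != v -> g u = h u.
  move=> uv nuv; apply: IHn; last first.
    by apply: contraNneq (descendants_root nv) => e; rewrite -{1}e.
  apply: leq_trans lt_n; apply: ltn_sub2l; first exact: size_tree_path.
  exact: descendants_size.
congr (_ - _ + _); apply: eq_bigr => u.
  case/andP=> uv op; apply: IH => //.
  by apply: contraTneq op => ->; rewrite opposite_parity_irr.
by case/andP=> /setD1P[nuv uv] _; apply: IH.
Qed.

Lemma charge_load u : charge D w u = parity D u * load D w u.
Proof.
have := side_disjoint D u; rewrite /charge /load /parity.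
have [ua|/mass_out ->] := boolP (u \in side_a D);
  have [ub|/mass_out ->] := boolP (u \in side_b D) => //= _; ring.
Qed.

Lemma load_a j : load D w (sa D j) = la w j.
Proof.
rewrite /load mass_inj ?mass_out ?addr0 //; last exact: sa_inj.
apply: contra (side_disjoint D (sa D j)) => jb; apply/andP; split=> //.
exact: imset_f.
Qed.

Lemma load_b i : load D w (sb D i) = lb w i.
Proof.
rewrite /load addrC mass_inj ?mass_out ?addr0 //; last exact: sb_inj.
apply: contra (side_disjoint D (sb D i)) => ia; apply/andP; split=> //.
exact: imset_f.
Qed.

Lemma parity_mul u v :
  parity D u * parity D v = (same_parity D u v)%:R - (opposite_parity D u v)%:R.
Proof.
have := side_disjoint D u; have := side_disjoint D v.
rewrite /same_parity /opposite_parity /parity.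
case: (u \in side_a D); case: (u \in side_b D); case: (v \in side_a D);
  case: (v \in side_b D) => //= _ _; ring.
Qed.

Lemma same_parity_refl u : u \in vertices D -> same_parity D u u.
Proof. by rewrite /same_parity !andbb inE. Qed.

(** The charge is parity times load, and a product of parities is 1 or -1
    according to whether the parities agree.  So [parity v * S v] is the load of
    the descendants of the parity of [v] minus that of the others; the load of
    [v] itself is one of its terms. *)
Lemma cut_mass_generic_step l v : v \in vertices D ->
  parity D v * cut_mass l (charge D w) v
    - generic_delta T / elen (parent_edge l v) =
  load D w v - generic_step l (load D w) v.
Proof.
move=> vD; rewrite /generic_step /cut_mass mulr_sumr.
transitivity (\sum_(u in descendants l v | same_parity D u v) load D w u
  - \sum_(u in descendants l v | opposite_parity D u v) load D w u
  - generic_delta T / elen (parent_edge l v)).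
  congr (_ - _); rewrite !big_mkcondr -sumrB; apply: eq_bigr => u _.
  rewrite charge_load mulrA [parity D v * _]mulrC parity_mul mulrBl.
  by do 2!case: ifP => _; rewrite ?mul1r ?mul0r.
rewrite (bigD1 v) /=; last by rewrite in_descendants_self same_parity_refl.
rewrite (eq_bigl (fun u => (u \in descendants l v :\ v) && same_parity D u v)).
  ring.
by move=> u; rewrite /= in_setD1 andbC andbA.
Qed.

Lemma load_root_total l : l \in vertices D ->
  \sum_(u | same_parity D u l) load D w u = 1.
Proof.
have sum_load (A : {set T}) : \sum_(u in A) load D w u =
    \sum_j la w j * (sa D j \in A)%:R + \sum_i lb w i * (sb D i \in A)%:R.
  rewrite -!(sum_mass _ _ (fun u => (u \in A)%:R)) -big_split big_mkcond /=.
  apply: eq_bigr => u _; rewrite -mulrDl.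
  by case: ifP; rewrite ?mulr1 ?mulr0.
have aa j : sa D j \in side_a D by apply: imset_f.
have bb i : sb D i \in side_b D by apply: imset_f.
have ab j : sa D j \in side_b D = false.
  by have := side_disjoint D (sa D j); rewrite aa => /negPf.
have ba i : sb D i \in side_a D = false.
  by have := side_disjoint D (sb D i); rewrite bb andbT => /negPf.
rewrite inE => Hl; have := side_disjoint D l; case/orP: Hl => Hl; rewrite Hl.
  move=> /= /negPf nl; rewrite (eq_bigl (mem (side_a D))); last first.
    by move=> u; rewrite /same_parity Hl nl andbT andbF orbF.
  rewrite sum_load; under eq_bigr do rewrite aa mulr1.
  by rewrite la_sum big1 ?addr0 // => i _; rewrite ba mulr0.
rewrite andbT => /negPf nl; rewrite (eq_bigl (mem (side_b D))); last first.
  by move=> u; rewrite /same_parity Hl nl andbT andbF.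
rewrite sum_load addrC; under eq_bigr do rewrite bb mulr1.
by rewrite lb_sum big1 ?addr0 // => j _; rewrite ab mulr0.
Qed.

(** The weight of the root imposes nothing new, as the load on the side of the
    root has total 1. *)
Lemma generically_weighted_generic_step l : vertices D = [set: T] ->
  generically_weighted D l w <->
  forall v, v != l -> load D w v = generic_step l (load D w) v.
Proof.
move=> DT; set g := generic_weight D l (generic_delta T).
have gE v : v != l -> g v = generic_step l g v.
  by move=> nv; apply: generic_weightE.
transitivity (forall u, load D w u = g u).
  split=> [[Ha Hb] u|H]; last by split=> k; rewrite -?load_a -?load_b H.
  have : u \in vertices D by rewrite DT inE.
  by rewrite inE => /orP[]/imsetP[k _ ->]; rewrite ?load_a ?load_b.
split=> [H v nv|H u].
  rewrite H gE // /generic_step; congr (_ - _ + _);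
    by apply: eq_bigr => u _; rewrite H.
have off := generic_step_unique H gE.
have [->|/off //] := eqVneq u l.
have lD : l \in vertices D by rewrite DT inE.
rewrite /g generic_weight_root -(load_root_total lD) (bigD1 l) ?same_parity_refl //=.
apply/esym/eqP; rewrite subr_eq; apply/eqP; congr (_ + _).
by apply: eq_big => [v|v /andP[_ /off]] //; rewrite andbC.
Qed.

(** For a vertex [v] whose parity is opposite to that of its parent, the slope at
    [v] is the parity of [v]; multiplying the condition on the charge below [v]
    by this sign gives the rule of the generic algorithm. *)
Lemma gap_eq_delta (hq : (0 < q)%N) (ht : (0 < t)%N) l :
  gap D w = generic_delta T <->
  [/\ vertices D = [set: T], generically_labeled D & generically_weighted D l w].
Proof.
have [_ gapE] := gap_ge_delta D w l.
have step v : vertices D = [set: T] -> v != l ->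
    opposite_parity D v (parent l v) ->
    (cut_mass l (charge D w) v == optimal_flow D l v) =
    (load D w v == generic_step l (load D w) v).
  move=> DT nv opp; have vD : v \in vertices D by rewrite DT inE.
  have sv : parity D v * parity D v = 1.
    by rewrite parity_mul same_parity_refl // opposite_parity_irr subr0.
  have sp : parity D v * parity D (parent l v) = -1.
    move: opp; have := side_disjoint D v; have := side_disjoint D (parent l v).
    rewrite /parity /opposite_parity.
    by do 4!case: (_ \in _) => //=; move=> *; ring.
  have svu : parity D v != 0.
    by apply: contra_eq_neq sv => ->; rewrite mul0r eq_sym oner_eq0.
  rewrite -subr_eq0 -[RHS]subr_eq0 -cut_mass_generic_step //.
  rewrite -[RHS](inj_eq (mulfI svu)) mulr0; congr (_ == _).
  rewrite [RHS]mulrBr; congr (_ - _); first by rewrite mulrA sv mul1r.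
  rewrite /optimal_flow.
  have -> : slope D l v = parity D v.
    by apply: (mulfI svu); rewrite sv /slope mulrA mulrBr sv sp; field.
  by rewrite mulrAC mulrC.
split=> [/esym/eqP|[DT gl gw]].
  rewrite gapE => /'forall_implyP H.
  have opp v : v != l -> opposite_parity D v (parent l v) by move=> /H/andP[].
  have [DT gl] := (opposite_parents hq ht l).1 opp.
  split=> //; apply/(generically_weighted_generic_step l DT) => v nv.
  by apply/eqP; rewrite -step ?opp //; case/andP: (H v nv).
have opp := (opposite_parents hq ht l).2 (conj DT gl).
apply/esym/eqP; rewrite gapE; apply/forall_inP => v nv.
rewrite opp // step ?opp //; apply/eqP.
exact: (generically_weighted_generic_step l DT).1.
Qed.

End Equality.

Theorem theorem4p12 (R : realFieldType) (T : metric_tree R) (q t : nat)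
    (hq : (0 < q)%N) (ht : (0 < t)%N)
    (D : simplex T q t) (w : normalized_load R q t) :
  let lhs :=
    \sum_(j1 < q) \sum_(j2 < q | (j1 < j2)%N)
      la w j1 * la w j2 * dist (sa D j1) (sa D j2)
    + \sum_(i1 < t) \sum_(i2 < t | (i1 < i2)%N)
      lb w i1 * lb w i2 * dist (sb D i1) (sb D i2)
    + (\sum_(e in edges T) (elen e)^-1)^-1 in
  let rhs :=
    \sum_(j < q) \sum_(i < t) la w j * lb w i * dist (sa D j) (sb D i) in
  lhs <= rhs /\
  forall l : T, is_leaf l ->
    (lhs = rhs <->
     [/\ vertices D = [set: T], generically_labeled D
       & generically_weighted D l w]).
Proof.
move=> lhs rhs.
have gapE : gap D w - generic_delta T = rhs - lhs.
  by rewrite /gap /lhs /rhs /generic_delta; ring.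
split=> [|l _].
  have [le_gap _] := gap_ge_delta D w (sa D (Ordinal hq)).
  by rewrite -subr_ge0 -gapE subr_ge0.
rewrite -(gap_eq_delta D w hq ht l); split=> E.
  by apply/eqP; rewrite -subr_eq0 gapE E subrr.
by apply/esym/eqP; rewrite -subr_eq0 -gapE E subrr.
Qed.
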